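(* Let $p$ be an odd prime and $k$ an algebraically closed field of characteristic $p$. Let $q$ be a prime power such that $p$ exactly divides $q-1$ and $T = \mathrm{PSL}_2(q)$ is simple, and let $T_1\le T$ be a dihedral subgroup of order $2p$ such that some left coset $tT_1$ ($t\in T$) contains no element of order prime to $p$. Let $L$ be a cyclic group of order $2$ and $m = [T:T_1]$. Let $G = L\wr T = N\rtimes T$ be the permutational wreath product, with $N = L_1\times\cdots\times L_m$ (of order $2^m$) indexed by the left cosets of $T_1$ in $T$ ($L_1$ corresponding to $T_1$) and $T$ permuting the factors as it permutes these cosets. Let $K = NT_1$ and let $W$ be the $1$-dimensional $kK$-module on which $L_1$ acts by the nontrivial character and $L_2\times\cdots\times L_m$ and $T_1$ act trivially. Set $V = \mathrm{Ind}_K^G(W)$. Then: (1) $V$ is an absolutely irreducible $kG$-module of dimension $m$, which is prime to $p$; (2) $H^1(G,k) = 0$, $p\nmid\dim V$, and $H^1(G,V\otimes V^* ) = 0$; and (3) $(G,V)$ is not adequate (indeed, $\mathrm{End}_k(V)$ is not spanned by the images of elements of $G$ acting semisimply on $V$).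
   Context: For an absolutely irreducible representation $\rho:G\to\mathrm{GL}(V)$ over $k$ of characteristic $p$, $(G,V)$ is adequate if: (1) $H^1(G,k)=0$; (2) $p\nmid\dim V$; (3) $H^1(G,V\otimes V^* )=0$; (4) $\mathrm{End}_k(V)$ is spanned by the elements $\rho(g)$ with $\rho(g)$ semisimple. *)

(* Defs.v *)
From HB Require Import structures.
From mathcomp Require Import all_boot all_order all_algebra all_fingroup all_solvable all_field all_character.
Set Implicit Arguments. Unset Strict Implicit. Unset Printing Implicit Defensive.
Import GRing.Theory.
Local Open Scope ring_scope.

Definition SL2set (Fq : finFieldType) : {set {'GL_2[Fq]}} :=
  [set g : {'GL_2[Fq]} | \det (GLval g) == 1].
Definition SL2 (Fq : finFieldType) : {group {'GL_2[Fq]}} := <<SL2set Fq>>%G.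
Definition PSL2 (Fq : finFieldType) := (SL2 Fq / 'Z(SL2 Fq))%G.

Definition H1_zero (gT : finGroupType) (G : {set gT}) (M : zmodType)
  (act : M -> gT -> M) : Prop :=
  forall f : gT -> M,
    (forall x y, x \in G -> y \in G -> f (x * y)%g = act (f x) y + f y) ->
    exists v : M, forall x, x \in G -> f x = act v x - v.

Definition triv_act (F : fieldType) (gT : finGroupType) (a : F) (g : gT) : F := a.

(* V (x) V^* = End_k(V), with G acting (on the right) by conjugation *)
Definition end_act (F : fieldType) (gT : finGroupType) (G : {group gT}) n
  (rG : mx_representation F G n) (A : 'M[F]_n) (g : gT) : 'M[F]_n :=
  invmx (rG g) *m A *m rG g.

(* End_k(V) is spanned by the rho(g) with rho(g) semisimple
   (k algebraically closed: semisimple = diagonalizable) *)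
Definition spanned_by_semisimple (F : fieldType) (gT : finGroupType)
  (G : {group gT}) n (rG : mx_representation F G n) : Prop :=
  forall A : 'M[F]_n, exists c : gT -> F,
    (forall g, g \in G -> c g != 0 -> diagonalizable (rG g)) /\
    A = \sum_(g in G) c g *: rG g.

(* adequacy (for an absolutely irreducible representation, char k = p) *)
Definition adequate (p : nat) (F : fieldType) (gT : finGroupType)
  (G : {group gT}) n (rG : mx_representation F G n) : Prop :=
  [/\ H1_zero G (@triv_act F gT), ~~ (p %| n)%N,
      H1_zero G (end_act rG) & spanned_by_semisimple rG].

(* Matrix of the induced representation Ind_K^G(W) of a 1-dimensional
   representation w of K, for right modules (row vectors), w.r.t. the right
   transversal X of K in G:  entry (i,j) = w(r_i g r_j^-1) if it lies in K. *)
Definition ind1_mx (F : fieldType) (gT : finGroupType) (K X : {set gT})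
  (w : gT -> F) (g : gT) : 'M[F]_#|X| :=
  \matrix_(i, j)
    (let h := (enum_val i * g * (enum_val j)^-1)%g in
     if h \in K then w h else 0).

(* Main.v *)
(* In the basis of V indexed by the transversal, N acts by diagonal matrices and
   the involution of the i-th line of N acts as 1 - 2 E_ii; as K \ G is a
   transitive G-set this yields all matrix units, hence absolute irreducibility.
   Since N is a p'-group, a cocycle G -> End V can be made trivial on N by
   averaging; its values then commute with N, hence are diagonal, so it lives in
   the permutation module on K \ G, and Shapiro's lemma reduces its triviality to
   Hom(K, k) = 0: N has order prime to p and T1 is generated by involutions.
   Finally, if g acts diagonalizably then its image s in T has order prime to p,
   so s^-1 is not in t T1; thus a fixed matrix entry, at positions x_i in K and
   x_j in K t^-1, vanishes on all semisimple elements. *)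
Require Import Defs.
From HB Require Import structures.
From mathcomp Require Import all_boot all_order all_algebra all_fingroup all_solvable all_field all_character.
Set Implicit Arguments. Unset Strict Implicit. Unset Printing Implicit Defensive.
Import GRing.Theory.

(** * The order of SL_2(q) *)

Section SL2Order.

Variable Fq : finFieldType.
Local Open Scope group_scope.

(** The default [1] is never reached, since determinants on GL_2 are units. With values in the unit
    group this is a group morphism, and its kernel is SL_2. *)
Definition GL2_det (g : {'GL_2[Fq]}) : {unit Fq} :=
  insubd (1 : {unit Fq}) (\det (GLval g))%R.

Lemma val_GL2_det g : val (GL2_det g) = (\det (GLval g))%R.
Proof. by rewrite val_insubd unitfE GL_det. Qed.

Lemma GL2_detM : {in 'GL_2[Fq] &, {morph GL2_det : x y / x * y}}.
Proof.
move=> x y _ _; apply: val_inj.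
by rewrite [RHS]FinRing.val_unitM !val_GL2_det GL_ME det_mulmx.
Qed.

Canonical GL2_det_morphism := Morphism GL2_detM.

Lemma SL2_ker : SL2 Fq = 'ker GL2_det :> {set _}.
Proof.
rewrite /= -[RHS]genGid; congr <<_>>; apply/setP=> g; rewrite !inE.
by rewrite -val_eqE /= val_GL2_det.
Qed.

Lemma GL2_det_surj : GL2_det @* 'GL_2[Fq] = [set: {unit Fq}].
Proof.
apply/setP=> u; rewrite inE; apply/morphimP.
pose A : 'M[Fq]_2 := (block_mx (val u)%:M 0 0 1%:M : 'M_(1 + 1))%R.
have detA : (\det A = val u)%R.
  by rewrite [LHS](@det_ublock Fq 1 1 (val u)%:M%R 0%R 1%:M%R) det1 det_scalar1 mulr1.
have uA : A \in unitmx by rewrite unitmxE detA (valP u).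
exists (FinRing.Unit uA : {'GL_2[Fq]}); rewrite ?inE //.
by apply: val_inj; rewrite val_GL2_det.
Qed.

(** The determinant maps GL_2 onto a group of order q - 1, so the index of its kernel is known and
    Lagrange applies. *)
Lemma card_SL2 : #|SL2 Fq| = (#|Fq| * #|Fq|.-1 * #|Fq|.+1)%N.
Proof.
have q1 : (0 < #|Fq|.-1)%N by rewrite -card_finField_unit; apply/card_gt0P; exists 1.
have sSG : SL2 Fq \subset 'GL_2[Fq] by apply: subsetT.
have := Lagrange sSG.
have ->: #|'GL_2[Fq] : SL2 Fq| = #|Fq|.-1.
  by rewrite -card_finField_unit -GL2_det_surj card_morphim setIid SL2_ker.
rewrite card_GL_2 -mulnn mulnA [RHS]mulnAC => /eqP.
by rewrite eqn_pmul2r // => /eqP.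
Qed.

End SL2Order.

(** If [p] divided both the index and the order of [T1], then p^2 would divide |SL_2(q)| =
    q(q-1)(q+1). Being prime to q and q+1, it would divide q-1. *)
Lemma PSL2_index_prime_to_p (p : nat) (Fq : finFieldType) (gT : finGroupType)
    (T T1 : {group gT}) :
  prime p -> odd p -> (p %| #|Fq| - 1)%N -> ~~ (p ^ 2 %| #|Fq| - 1)%N ->
  (T \isog PSL2 Fq)%g -> T1 \subset T -> (p %| #|T1|)%N ->
  ~~ (p %| #|T : T1|%g)%N.
Proof.
move=> p_pr p_odd pq1 p2q1 /card_isog oT sT1 pT1; apply: contra p2q1 => pi.
have: (p ^ 2 %| #|SL2 Fq|)%N.
  apply: (@dvdn_trans #|T|); last by rewrite oT dvdn_quotient.
  by rewrite -(Lagrange sT1) -mulnn dvdn_mul.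
have q_gt0 : (0 < #|Fq|)%N by apply/card_gt0P; exists 0%R.
have qE : #|Fq| = (#|Fq| - 1 + 1)%N by rewrite subnK.
have co1 : coprime (p ^ 2) #|Fq|.
  by rewrite coprimeXl // prime_coprime // qE dvdn_addr // dvdn1 gtn_eqF ?prime_gt1.
(* As q + 1 = (q - 1) + 2, a common factor would force [p] to divide 2. *)
have co2 : coprime (p ^ 2) #|Fq|.+1.
  rewrite coprimeXl // prime_coprime // qE -addn1 -addnA dvdn_addr //.
  by apply: contraL p_odd => /(prime_nt_dvdP (isT : prime 2) (negbT (gtn_eqF (prime_gt1 p_pr))))->.
by rewrite card_SL2 Gauss_dvdl // Gauss_dvdr // subn1.
Qed.

Local Open Scope ring_scope.

(** * Vanishing of additive maps on groups *)

Lemma additive_on_expg {gT : finGroupType} {V : zmodType} {H : {group gT}} {f : gT -> V} :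
  {in H &, forall x y, f (x * y)%g = f x + f y} ->
  forall x n, x \in H -> f (x ^+ n)%g = f x *+ n.
Proof.
move=> fM x n Hx.
have f1 : f 1%g = 0.
  by apply: (addIr (f 1%g)); rewrite add0r -fM ?group1 ?mulg1.
by elim: n => [|n IHn]; rewrite ?mulr0n // expgS fM ?groupX // IHn mulrS.
Qed.

Lemma additive_on_gen {gT : finGroupType} {V : zmodType} {H : {group gT}}
    {A : {set gT}} {f : gT -> V} :
  {in H &, forall x y, f (x * y)%g = f x + f y} -> A \subset H ->
  {in A, forall x, f x = 0} -> {in <<A>>%g, forall x, f x = 0}.
Proof.
move=> fM sAH fA; pose Z := [set x in H | f x == 0].
have f1 := additive_on_expg fM 0 (group1 H).
have gZ : group_set Z.
  apply/group_setP; split=> [|x y]; rewrite !inE ?group1 /=.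
    by rewrite -(expg0 1%g) f1 mulr0n.
  by move=> /andP[Hx /eqP fx] /andP[Hy /eqP fy]; rewrite groupM // fM // fx fy addr0 /=.
have sAZ : A \subset Group gZ.
  by apply/subsetP=> x Ax; rewrite inE (subsetP sAH) //= fA.
move=> x; rewrite -gen_subG in sAZ; move=> /(subsetP sAZ).
by rewrite inE => /andP[_ /eqP].
Qed.

Lemma additive_on_coprime {gT : finGroupType} {F : fieldType} {H : {group gT}}
    {f : gT -> F} {x : gT} (n : nat) :
  {in H &, forall x y, f (x * y)%g = f x + f y} -> x \in H ->
  n%:R != 0 :> F -> (x ^+ n)%g = 1%g -> f x = 0.
Proof.
move=> fM Hx n0 xn; apply: (mulIf n0); rewrite mul0r mulr_natr.
rewrite -(additive_on_expg fM) // xn -(expg0 1%g).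
by rewrite (additive_on_expg fM) ?group1.
Qed.

(** The presentation by two involutions is used: each generator is killed because 2 is invertible in
    [F]. *)
Lemma additive_on_dihedral {gT : finGroupType} {F : fieldType} {H D : {group gT}}
    {f : gT -> F} {m : nat} :
  {in H &, forall x y, f (x * y)%g = f x + f y} -> D \subset H ->
  (1 < m)%N -> (D \isog 'D_(2 * m))%g -> 2%:R != 0 :> F ->
  {in D, forall x, f x = 0}.
Proof.
move=> fM sDH m1 isoD F2.
move: isoD; rewrite mul2n => /(isoGrpP _ (Grp'_dihedral m1))[_].
case/existsP=> -[x y] /= /eqP[defD x2 y2 _].
have sAD : x |: [set y] \subset D by rewrite -defD joing_idl joing_idr subset_gen.
have sAH := subset_trans sAD sDH.
rewrite -defD joing_idl joing_idr; apply: (additive_on_gen fM sAH) => z.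
move=> Az; apply: (additive_on_coprime (n := 2) fM (subsetP sAH z Az) F2).
by move: Az; rewrite !inE => /orP[]/eqP->.
Qed.

(** * Orders of elements acting diagonalizably *)

(** With y the power of [x] in question and P the characteristic part of [n], Frobenius gives (y -
    1)^P = y^P - 1 = 0, and a field has no nilpotents. *)
Lemma expr_pchar_part_eq1 {F : fieldType} (x : F) (n : nat) :
  (0 < n)%N -> x ^+ n = 1 -> x ^+ n`_[pchar F]^' = 1.
Proof.
move=> n_gt0; rewrite -{1}(partnC [pchar F] n_gt0) mulnC exprM.
set y := x ^+ _ => yq; apply/eqP; rewrite -subr_eq0.
suff: (y - 1) ^+ n`_[pchar F] == 0 by rewrite expf_eq0 => /andP[].
rewrite -(inj_eq (addIr 1)) add0r.
have /esym := exprDn_pchar (y - 1) 1 (part_pnat [pchar F] n).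
by rewrite expr1n => ->; rewrite subrK yq.
Qed.

(** The eigenvalues are roots of unity of exponent the order of [g], so the preceding lemma applies
    to each diagonal entry. Modulo the kernel, [g] thus has order prime to the characteristic. *)
Lemma diagonalizable_repr_pchar' {F : fieldType} {gT : finGroupType} {G : {group gT}}
    {n : nat} (rG : mx_representation F G n) (g : gT) :
  g \in G -> diagonalizable (rG g) -> rG (g ^+ #[g]`_[pchar F]^')%g = 1%:M.
Proof.
move=> Gg [P uP /(similar_diagLR uP)[d]]; rewrite conjVmx // => gE.
have gX m : rG (g ^+ m)%g = invmx P *m diag_mx (\row_i d 0 i ^+ m) *m P.
  elim: m => [|m IHm].
    rewrite expg0 repr_mx1 (_ : diag_mx _ = 1%:M) ?mulmx1 ?mulVmx //.
    by rewrite -diag_const_mx; congr diag_mx; apply/rowP=> i; rewrite !mxE expr0.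
  rewrite expgS repr_mxM ?groupX // IHm gE !mulmxA mulmxK //.
  rewrite -[in LHS](mulmxA (invmx P)) mulmx_diag; congr (_ *m diag_mx _ *m _).
  by apply/rowP=> i; rewrite !mxE exprS.
rewrite gX (_ : diag_mx _ = 1%:M) ?mulmx1 ?mulVmx //.
rewrite -diag_const_mx; congr diag_mx; apply/rowP=> i; rewrite !mxE.
apply: expr_pchar_part_eq1 => //.
have /(congr1 (fun A => P *m A *m invmx P)) := gX #[g]%g.
rewrite expg_order repr_mx1 mulmx1 mulmxV // !mulmxA mulmxV // mul1mx mulmxK //.
by move/matrixP/(_ i i); rewrite !mxE eqxx !mulr1n => <-.
Qed.

(** * The conjugation action on endomorphisms *)

Lemma end_actB {F : fieldType} {gT : finGroupType} {G : {group gT}} {n : nat}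
    (rG : mx_representation F G n) A B g :
  end_act rG (A - B) g = end_act rG A g - end_act rG B g.
Proof. by rewrite /end_act mulmxBr mulmxBl. Qed.

Lemma end_actM {F : fieldType} {gT : finGroupType} {G : {group gT}} {n : nat}
    (rG : mx_representation F G n) A x y :
  x \in G -> y \in G -> end_act rG A (x * y)%g = end_act rG (end_act rG A x) y.
Proof.
move=> Gx Gy; rewrite /end_act -!repr_mxV ?groupM // invMg.
by rewrite !repr_mxM ?groupV // !mulmxA.
Qed.

Lemma end_act_eq {F : fieldType} {gT : finGroupType} {G : {group gT}} {n : nat}
    (rG : mx_representation F G n) A B g :
  g \in G -> (end_act rG A g == B) = (A *m rG g == rG g *m B).
Proof.
move=> Gg; have ug := repr_mx_unit rG Gg; rewrite /end_act -mulmxA.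
by apply/eqP/eqP=> [<- | ->]; rewrite ?mulKVmx ?mulKmx.
Qed.

(* Averaging over [N]. *)
Lemma H1_zero_invertible_order {F : fieldType} {gT : finGroupType}
    {G N : {group gT}} {n : nat} (rG : mx_representation F G n) :
  N \subset G -> #|N|%:R != 0 :> F -> H1_zero N (end_act rG).
Proof.
move=> sNG N0 f fM; pose S := \sum_(x in N) f x.
exists (- (#|N|%:R^-1 *: S)) => y Ny.
have actS : end_act rG S y + f y *+ #|N| = S.
  rewrite [RHS](reindex_inj (mulIg y)) /=.
  under [RHS]eq_bigl do rewrite groupMr //.
  rewrite (eq_bigr (fun x => end_act rG (f x) y + f y)) => [|x Nx]; last exact: fM.
  by rewrite big_split sumr_const /end_act mulmx_sumr mulmx_suml.
rewrite opprK /end_act mulmxN mulNmx -scalemxAr -scalemxAl -scalerN -scalerDr.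
rewrite -/(end_act rG S y) -{2}actS addKr -scaler_nat scalerA mulVf //.
by rewrite scale1r.
Qed.

(** * Representations induced from a line *)

Section InducedLine.

Variables (F : fieldType) (gT : finGroupType) (G K : {group gT}) (X : {set gT}).
Variables (w : gT -> F) (rV : mx_representation F G #|X|).
Hypothesis sKG : K \subset G.
Hypothesis trX : is_transversal X (rcosets K G) G.
Hypothesis rV_ind : forall g, g \in G -> rV g = ind1_mx K X w g.
Hypothesis w_neq0 : forall x, x \in K -> w x != 0.

Local Notation x_ := (enum_val : 'I_#|X| -> gT).

(* The right coset action on indices: [K x_i g = K x_j]. *)
Definition moves (i : 'I_#|X|) (g : gT) (j : 'I_#|X|) : bool :=
  (x_ i * g * (x_ j)^-1)%g \in K.

Lemma card_ind : #|X| = #|G : K|%g.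
Proof. exact: card_transversal trX. Qed.

Lemma rep_in i : x_ i \in G.
Proof. exact: (subsetP (transversal_sub trX)) (enum_valP i). Qed.

Lemma rep_exists g : g \in G -> exists j, (g * (x_ j)^-1)%g \in K.
Proof.
move=> Gg; have Kg : (K :* g)%g \in rcosets K G by apply/rcosetsP; exists g.
have Xy := repr_mem_transversal trX 1%g Kg.
have := repr_mem_pblock trX 1%g Kg.
set y := transversal_repr _ _ _ in Xy * => /rcosetP[k Kk yE].
exists (enum_rank_in Xy y); rewrite enum_rankK_in // yE invMg mulKVg ?groupV //.
Qed.

Lemma rep_inj i j : (x_ i * (x_ j)^-1)%g \in K -> i = j.
Proof.
move=> Kij; apply: enum_val_inj; apply: (pblock_inj trX); try exact: enum_valP.
have [/and3P[_ tI _] _] := andP trX.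
have memK y : y \in G -> pblock (rcosets K G) y = (K :* y)%g.
  by move=> Gy; apply: def_pblock => //; [apply/rcosetsP; exists y | apply: rcoset_refl].
by rewrite !memK ?rep_in //; apply/rcoset_eqP; rewrite mem_rcoset.
Qed.

Lemma movesM {x y i j l} : moves i x j -> moves j y l -> moves i (x * y) l.
Proof. by rewrite /moves => Kx /(groupM Kx); rewrite !mulgA mulgKV. Qed.

Lemma movesV {x i j} : moves i x j -> moves j x^-1 i.
Proof. by rewrite /moves -groupV !invMg !invgK !mulgA. Qed.

Lemma moves_exists i j : exists2 g, g \in G & moves i g j.
Proof.
exists ((x_ i)^-1 * x_ j)%g; first by rewrite groupM ?groupV ?rep_in.
by rewrite /moves mulKVg mulgV group1.
Qed.

Lemma ind_entry_neq0 g i j : g \in G -> (rV g i j != 0) = moves i g j.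
Proof.
move=> Gg; rewrite rV_ind // mxE /= -/(moves i g j).
by case: ifP => [/w_neq0 //|]; rewrite eqxx.
Qed.

(** By transitivity some [rV g] has a nonzero (i,j) entry, and E_ii [rV g] E_jj is that entry times
    E_ij. So the enveloping algebra contains every matrix unit. *)
Lemma ind_abs_irr :
  (forall i, delta_mx i i \in enveloping_algebra_mx rV)%MS ->
  mx_absolutely_irreducible rV.
Proof.
move=> Eii; apply/andP; split; first by rewrite card_ind indexg_gt0.
rewrite -sub1mx; apply/row_subP=> a.
have E i j : (delta_mx i j \in enveloping_algebra_mx rV)%MS.
  have [g Gg] := moves_exists i j; rewrite -ind_entry_neq0 // => gij.
  have := envelop_mxM (envelop_mxM (Eii i) (envelop_mx_id rV Gg)) (Eii j).
  have -> : delta_mx i i *m rV g *m delta_mx j j = rV g i j *: delta_mx i j.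
    rewrite -(mul_delta_mx (0 : 'I_1) i i) -(mul_delta_mx (0 : 'I_1) j j).
    rewrite -!mulmxA (mulmxA (rV g)) (mulmxA (delta_mx 0 i)) (mulmxA (delta_mx 0 i)).
    rewrite -rowE -colE [col _ _]mx11_scalar !mxE mul_scalar_mx.
    by rewrite -scalemxAr mul_delta_mx.
  by rewrite linearZ eqmx_scale.
rewrite -[row a _]vec_mxK [vec_mx _]matrix_sum_delta linear_sum. apply: summx_sub => i _.
by rewrite linear_sum; apply: summx_sub => j _; rewrite linearZ scalemx_sub ?E.
Qed.

(* Shapiro's lemma in coordinates: a cocycle with diagonal values is the same as
   a cocycle of the permutation module on K \ G, whose class is determined by an
   additive map on a point stabiliser. *)
Lemma diag_cocycle_coboundary (i0 : 'I_#|X|) (f : gT -> 'M[F]_#|X|) :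
    (forall x y, x \in G -> y \in G -> f (x * y)%g = end_act rV (f x) y + f y) ->
    (forall x, x \in G -> is_diag_mx (f x)) ->
    (forall a : gT -> F, {in K &, forall x y, a (x * y)%g = a x + a y} ->
       {in K, forall x, a x = 0}) ->
  exists v : 'M[F]_#|X|, forall x, x \in G -> f x = end_act rV v x - v.
Proof.
move=> fM fdiag homK0.
have rowE A x i j : is_diag_mx A -> (A *m rV x) i j = A i i * rV x i j.
  move=> /is_diag_mxP dA; rewrite mxE (bigD1 i) //= big1 ?addr0 // => k ki.
  by rewrite dA ?mul0r // eq_sym.
have colE A x i j : is_diag_mx A -> (rV x *m A) i j = rV x i j * A j j.
  move=> /is_diag_mxP dA; rewrite mxE (bigD1 j) //= big1 ?addr0 // => k kj.
  by rewrite dA ?mulr0.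
(* The (i,j) entries of the cocycle identity are compared, and the nonzero factor [rV y i j]
   cancels. *)
have fMe x y i j : x \in G -> y \in G -> moves i y j ->
    f (x * y)%g j j = f x i i + f y j j.
  move=> Gx Gy mij; have /eqP := fM x y Gx Gy.
  rewrite -subr_eq eq_sym end_act_eq // => /eqP/matrixP/(_ i j).
  have dB : is_diag_mx (f (x * y)%g - f y).
    apply/is_diag_mxP=> a b ab; rewrite !mxE.
    by rewrite !(is_diag_mxP (fdiag _ _)) ?groupM ?subrr.
  rewrite rowE ?colE ?fdiag // mulrC => /mulfI-> //; last by rewrite ind_entry_neq0.
  by rewrite !mxE subrK.
(* The stabiliser of [i0] is a conjugate of [K]; transported to [K], this entry becomes an additive
   map. *)
have f0 k : k \in G -> moves i0 k i0 -> f k i0 i0 = 0.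
  move=> Gk Kk; pose a x := f (x ^ x_ i0)%g i0 i0.
  have -> : f k i0 i0 = a (x_ i0 * k * (x_ i0)^-1)%g.
    by rewrite /a conjgE !mulgA mulVg mul1g mulgKV.
  apply: homK0 => // x y Kx Ky; rewrite /a conjMg; apply: fMe.
  - by rewrite groupJ ?rep_in // (subsetP sKG).
  - by rewrite groupJ ?rep_in // (subsetP sKG).
  by rewrite /moves conjgE !mulgA mulgK mulgV mul1g.
pose g_ j := s2val (sig2W (moves_exists i0 j)).
have Gg_ j : g_ j \in G by rewrite /g_; case: sig2W.
have mg_ j : moves i0 (g_ j) j by rewrite /g_; case: sig2W.
(* Two elements carrying [i0] to [j] differ by a stabiliser element, where the entry vanishes; so
   the entry depends only on [j] and defines the bounding matrix below. *)
have ind_f x j : x \in G -> moves i0 x j -> f x j j = f (g_ j) j j.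
  move=> Gx mx; have Gxg : (x * (g_ j)^-1)%g \in G by rewrite groupM ?groupV.
  rewrite -{1}(mulgKV (g_ j) x) (fMe _ _ i0) // f0 ?add0r //.
  exact: movesM mx (movesV (mg_ j)).
exists (- diag_mx (\row_j f (g_ j) j j)) => y Gy; apply/eqP.
rewrite eq_sym subr_eq end_act_eq //; apply/eqP/matrixP=> i j.
have dv : is_diag_mx (- diag_mx (\row_j f (g_ j) j j)).
  by rewrite -raddfN; apply: diag_mx_is_diag.
have dB : is_diag_mx (f y - diag_mx (\row_j f (g_ j) j j)).
  apply/is_diag_mxP=> a b ab; rewrite !mxE (negPf (ab : a != b)) mulr0n subr0.
  by rewrite (is_diag_mxP (fdiag _ Gy)).
rewrite rowE // colE // mulrC !mxE !eqxx !mulr1n.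
have [/eqP-> | ] := boolP (rV y i j == 0); first by rewrite !mul0r.
rewrite ind_entry_neq0 // => mij; congr (_ * _).
rewrite -(ind_f (g_ i * y)%g j) ?groupM //; last exact: movesM (mg_ i) mij.
by rewrite (fMe _ _ i) // opprD addrCA subrr addr0.
Qed.

(** After subtracting a coboundary, the cocycle h vanishes on [N]. For y in [N], writing xy = (x y
    x^-1) x gives h(xy) = h(x), while the cocycle rule gives h(xy) = h(x) acted on by y. Hence h(x)
    is fixed by [N] and so diagonal. *)
Lemma H1_zero_ind_end (N : {group gT}) (i0 : 'I_#|X|) :
    (N <| G)%g -> #|N|%:R != 0 :> F ->
    (forall A, (forall x, x \in N -> end_act rV A x = A) -> is_diag_mx A) ->
    (forall a : gT -> F, {in K &, forall x y, a (x * y)%g = a x + a y} ->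
       {in K, forall x, a x = 0}) ->
  H1_zero G (end_act rV).
Proof.
move=> /andP[sNG nNG] N0 Ndiag homK0 f fM.
have [|v fv] := @H1_zero_invertible_order _ _ _ _ _ rV sNG N0 f.
  by move=> x y Nx Ny; apply: fM; apply: (subsetP sNG).
pose h x := f x - (end_act rV v x - v).
have hM x y : x \in G -> y \in G -> h (x * y)%g = end_act rV (h x) y + h y.
  move=> Gx Gy; rewrite /h fM // !end_actB -end_actM //.
  by rewrite !opprB [RHS]addrACA; congr (_ + _); rewrite [RHS]addrC subrKA.
have hN x : x \in N -> h x = 0 by move=> Nx; rewrite /h fv ?subrr.
have [|u hu] := diag_cocycle_coboundary i0 hM _ homK0; last first.
- exists (u + v) => x Gx; rewrite -[f x](subrK (end_act rV v x - v)) -/(h x) hu //.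
  by rewrite /end_act mulmxDr mulmxDl opprD addrACA.
move=> x Gx; apply: Ndiag => y Ny; have Gy := subsetP sNG y Ny.
have := hM x y Gx Gy; rewrite (hN y Ny) addr0 => <-.
rewrite -(mulgKV x (x * y)%g) hM ?groupM ?groupV // hN.
  by rewrite /end_act mulmx0 mul0mx add0r.
by rewrite -mulgA -{1}[x]invgK -conjgE memJ_norm ?groupV // (subsetP nNG).
Qed.

Hypothesis two_neq0 : 2%:R != 0 :> F.

Lemma reflections_abs_irr :
  (forall i, exists2 z, z \in G & rV z = 1%:M - delta_mx i i *+ 2) ->
  mx_absolutely_irreducible rV.
Proof.
move=> refl; apply: ind_abs_irr => i; have [z Gz zE] := refl i.
have -> : delta_mx i i = 2%:R^-1 *: (1%:M - rV z).
  by rewrite zE opprB addrC subrK -scaler_nat scalerA mulVf // scale1r.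
by rewrite linearZ scalemx_sub // linearB addmx_sub ?envelop_mx1 // eqmx_opp envelop_mx_id.
Qed.

(** Commuting with 1 - 2 E_jj forces 2 A_ij = 0 for i different from j. *)
Lemma reflections_fixed_diag (A : 'M_#|X|) :
    (forall i, exists2 z, z \in G /\ end_act rV A z = A &
       rV z = 1%:M - delta_mx i i *+ 2) ->
  is_diag_mx A.
Proof.
move=> refl; apply/is_diag_mxP=> i j ij; have [z [Gz /eqP]] := refl j.
rewrite end_act_eq // => /eqP Az zE; move: Az.
rewrite zE mulmxBl mulmxBr mul1mx mulmx1 => /addrI/oppr_inj/matrixP/(_ i j).
rewrite -scaler_nat -scalemxAl -scalemxAr !mxE (bigD1 j) //= big1 => [|k kj].
  rewrite big1 => [|k _]; first by rewrite !mxE !eqxx mulr1 addr0 mulr0 => /eqP;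
    rewrite mulf_eq0 (negPf two_neq0) => /eqP.
  by rewrite !mxE (negPf (ij : i != j)) mul0r.
by rewrite !mxE (negPf kj) mulr0.
Qed.

(** The (i,j) coordinate vanishes on all semisimple images, but not on E_ij. *)
Lemma not_spanned_ind i j :
    (forall g, g \in G -> diagonalizable (rV g) -> ~~ moves i g j) ->
  ~ spanned_by_semisimple rV.
Proof.
move=> nomove span; have [c [css /matrixP/(_ i j)]] := span (delta_mx i j).
rewrite mxE !eqxx summxE big1 => [/eqP|g Gg]; first by rewrite oner_eq0.
rewrite mxE; have [->|/(css g Gg)/(nomove g Gg)] := eqVneq (c g) 0.
  by rewrite mul0r.
by rewrite -ind_entry_neq0 // negbK => /eqP->; rewrite mulr0.
Qed.

End InducedLine.

(** An additive map is constant on conjugacy classes, so it kills the normal closure of [D], which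
    is all of [T] by simplicity. *)
Lemma additive_on_simple {gT : finGroupType} {V : zmodType} {T D : {group gT}}
    {f : gT -> V} :
  {in T &, forall x y, f (x * y)%g = f x + f y} -> simple T -> D \subset T ->
  D :!=: 1%g -> {in D, forall x, f x = 0} -> {in T, forall x, f x = 0}.
Proof.
move=> fM /simpleP[_ simT] sDT D1 fD.
have fX y : y \in T -> f y^-1%g = - f y.
  move=> Ty; apply/eqP; rewrite -addr_eq0 -fM ?groupV // mulVg.
  by rewrite -(expg0 y) (additive_on_expg fM).
have nA : (<<class_support D T>> <| T)%g.
  by rewrite /normal gen_subG class_support_subG // norms_gen ?class_support_norm.
have [A1 | <-] := simT _ nA.
  by case/eqP: D1; apply/trivgP; rewrite -A1; apply/sub_gen/sub_class_support.
apply: (additive_on_gen fM); first exact: class_support_subG.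
move=> _ /imset2P[x y Dx Ty ->]; have Tx := subsetP sDT x Dx.
by rewrite conjgE !fM ?groupM ?groupV // fX // (fD x Dx) add0r addNr.
Qed.

(** * Structure of the wreath product *)

Section Wreath.

Local Open Scope group_scope.

Variables (gT : finGroupType) (G N K T T1 : {group gT}) (L : {set gT} -> {group gT}).
Hypothesis sT1T : T1 \subset T.
Hypothesis oL : forall C, C \in lcosets T1 T -> #|L C| = 2%N.
Hypothesis dprodN : \big[dprod/1]_(C in lcosets T1 T) L C = N.
Hypothesis sdprodG : N ><| T = G.
(** The inverse appears because conjugation is a right action while [T] moves left cosets from the
    left. *)
Hypothesis actL : forall t C, t \in T -> C \in lcosets T1 T -> L C :^ t^-1 = L (t *: C).
Hypothesis defK : K :=: N * T1.

Lemma lcoset_point : gval T1 \in lcosets T1 T.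
Proof. by apply/lcosetsP; exists 1; rewrite ?group1 // lcoset1. Qed.

Lemma card_base : #|N| = (2 ^ #|lcosets T1 T|)%N.
Proof.
by rewrite -(bigdprod_card dprodN) (eq_bigr (fun=> 2%N)) ?prod_nat_const.
Qed.

Lemma base_abelian : abelian N.
Proof.
rewrite -[gval N]dprodN; have /esym := center_bigdprod dprodN.
rewrite (eq_bigr (fun C => gval (L C))) => [|C TC].
  by rewrite dprodN => <-; apply: center_abelian.
by apply/center_idP/cyclic_abelian/prime_cyclic; rewrite oL.
Qed.

Lemma line_sub_base C : C \in lcosets T1 T -> L C \subset N.
Proof.
by move=> TC; rewrite -(bigdprodWY dprodN) sub_gen // (bigcup_max C).
Qed.

Lemma base_normal : N <| G.
Proof. by have [] := sdprod_context sdprodG. Qed.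

Lemma base_sub_stab : N \subset K.
Proof. by rewrite defK mulG_subl. Qed.

Lemma stab_sub : K \subset G.
Proof.
by rewrite defK -(sdprodW sdprodG) mulgS.
Qed.

(** In the factorisation g = n s along [N] and [T], [divgr N T g] is n and [remgr N T g] is s; the
    latter is the projection of [G] onto [T]. *)
Lemma remgr_mem g : g \in G -> remgr N T g \in T.
Proof. by rewrite -(sdprodW sdprodG); apply: mem_remgr. Qed.

Lemma divgr_mem g : g \in G -> divgr N T g \in N.
Proof. by rewrite -(sdprodW sdprodG); apply: mem_divgr. Qed.

Lemma base_compl : T \in [complements to N in G].
Proof. by have [_ _ eqG _ tiNT] := sdprod_context sdprodG; apply/complP. Qed.

Lemma remgr_morph : {in G &, {morph remgr N T : x y / x * y}}.
Proof. exact: remgrM base_compl base_normal. Qed.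

Lemma base_tiT : N :&: T = 1.
Proof. by have /complP[] := base_compl. Qed.

Lemma mem_stab_compl t : t \in T -> (t \in K) = (t \in T1).
Proof.
move=> Tt; apply/idP/idP => [|T1t]; last by rewrite defK (subsetP (mulG_subr _ _)).
rewrite defK => /mulsgP[n u Nn T1u tE].
suff n1 : n = 1 by rewrite tE n1 mul1g.
apply/set1gP; rewrite -base_tiT inE Nn /= -(mulgK u n) -tE.
by rewrite groupM // groupV (subsetP sT1T).
Qed.

Lemma mem_stab g : g \in G -> (g \in K) = (remgr N T g \in T1).
Proof.
move=> Gg; rewrite -mem_stab_compl ?remgr_mem //.
rewrite {1}(divgr_eq N T g) groupMl // (subsetP base_sub_stab) //.
exact: divgr_mem.
Qed.

Lemma index_stab : #|G : K| = #|T : T1|.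
Proof.
have tiNT1 : N :&: T1 = 1.
  by apply/trivgP; rewrite (subset_trans (setIS _ sT1T)) // base_tiT.
apply/eqP; rewrite -(eqn_pmul2l (cardG_gt0 K)) Lagrange ?stab_sub //.
by rewrite defK TI_cardMg // -mulnA Lagrange // (sdprod_card sdprodG).
Qed.

(** The [N]-part of [g] centralises z as [N] is abelian, and the [T]-part, lying outside [T1], moves
    the base coset. *)
Lemma conj_line_neq z g : z \in L T1 -> g \in G -> g \notin K ->
  exists2 C, C \in lcosets T1 T /\ C != T1 & z ^ g \in L C.
Proof.
move=> Lz Gg; rewrite mem_stab // => gT1.
have Tg := remgr_mem Gg; have Ng := divgr_mem Gg.
have Nz : z \in N := subsetP (line_sub_base lcoset_point) z Lz.
exists ((remgr N T g)^-1 *: T1).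
  split; first by apply/lcosetsP; exists (remgr N T g)^-1; rewrite ?groupV.
  apply: contra gT1 => /eqP eqT1; rewrite -groupV -eqT1.
  exact: lcoset_refl.
rewrite -actL ?groupV ?lcoset_point // invgK {1}(divgr_eq N T g) conjgM.
have -> : z ^ divgr N T g = z by apply/conjg_fixP/commgP; apply: (centsP base_abelian).
by rewrite memJ_conjg.
Qed.

(** The intersection of [N <*> H] with [T] is normal in [T] and contained in [T1], so simplicity
    makes it trivial; it contains the [T]-part of [g]. *)
Lemma core_trivial (H : {group gT}) g :
    simple T -> ~~ (T \subset T1) -> H <| G -> H \subset K -> g \in H ->
  remgr N T g = 1.
Proof.
move=> /simpleP[_ simT] nTT1 nHG sHK Hg.
have Gg : g \in G := subsetP (normal_sub nHG) g Hg.
have sTG : T \subset G by have [] := sdprod_context sdprodG.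
have nNH : N <*> H <| G by rewrite normalY ?base_normal.
have nI : (N <*> H) :&: T <| T.
  by rewrite /normal subsetIr normsI ?normG // (subset_trans sTG) ?normal_norm.
have sNHK : N <*> H \subset K by rewrite join_subG base_sub_stab.
have [I1 | IT] := simT _ nI.
  apply/set1gP; rewrite -I1 inE remgr_mem // andbT.
  have -> : remgr N T g = (divgr N T g)^-1 * g.
    by rewrite {3}(divgr_eq N T g) mulKg.
  by rewrite groupM ?groupV ?mem_gen // inE ?divgr_mem ?Hg ?orbT.
case/negP: nTT1; apply/subsetP=> t Tt; rewrite -mem_stab_compl //.
by apply: (subsetP sNHK); move: Tt; rewrite -{1}IT => /setIP[].
Qed.

Lemma remgrX_sdprod g m : g \in G -> remgr N T (g ^+ m) = remgr N T g ^+ m.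
Proof.
move=> Gg; elim: m => [|m IHm]; first by rewrite !expg0 remgr1.
by rewrite !expgS remgr_morph ?groupX // IHm.
Qed.

End Wreath.

(** * Irreducibility, cohomology and semisimple span for the induced module *)

Theorem theorem5p4 (p : nat) (F : closedFieldType) (Fq : finFieldType)
  (gT : finGroupType) (G N K T T1 : {group gT}) (L : {set gT} -> {group gT})
  (X : {set gT}) (rW : mx_representation F K 1)
  (rV : mx_representation F G #|X|) :
  prime p -> odd p -> (p \in [pchar F])%R ->
  (p %| #|Fq| - 1)%N -> ~~ (p ^ 2 %| #|Fq| - 1)%N ->
  (T \isog PSL2 Fq)%g -> simple T ->
  T1 \subset T -> (T1 \isog 'D_(2 * p))%g ->
  (exists2 t, t \in T & forall x, x \in (t *: T1)%g -> ~~ coprime #[x]%g p) ->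
  (forall C, C \in lcosets T1 T -> #|L C| = 2%N) ->
  (\big[dprod/1]_(C in lcosets T1 T) L C)%g = N ->
  (N ><| T)%g = G ->
  (forall t C, t \in T -> C \in lcosets T1 T -> (L C :^ t^-1)%g = L (t *: C)%g) ->
  K :=: (N * T1)%g ->
  (forall x, x \in L T1 -> x != 1%g -> rW x = (- 1)%R) ->
  (forall C x, C \in lcosets T1 T -> C != T1 -> x \in L C -> rW x = 1%R) ->
  (forall x, x \in T1 -> rW x = 1%R) ->
  is_transversal X (rcosets K G) G ->
  (forall g, g \in G -> rV g = ind1_mx K X (fun x => rW x ord0 ord0) g) ->
  [/\ [/\ mx_absolutely_irreducible rV, #|X| = #|T : T1|%g & ~~ (p %| #|T : T1|%g)%N],
      [/\ H1_zero G (@triv_act F gT), ~~ (p %| #|X|)%N & H1_zero G (end_act rV)]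
    & ~ adequate p rV /\ ~ spanned_by_semisimple rV].
Proof.
move=> p_pr p_odd chFp pq1 p2q1 isoT simT sT1T isoT1 [t Tt tT1] oL dprodN sdprodG.
move=> actL defK rW_L1 rW_L rW_T1 trX rV_ind.
have p_gt1 := prime_gt1 p_pr.
have two_neq0 : 2%:R != 0 :> F.
  rewrite -(dvdn_pcharf chFp); apply: contraL p_odd.
  by move/(prime_nt_dvdP (isT : prime 2) (negbT (gtn_eqF p_gt1)))->.
have sKG := stab_sub sT1T sdprodG defK.
have sNK := base_sub_stab defK.
have nNG := base_normal sdprodG.
have oT1 : #|T1| = (2 * p)%N.
  by rewrite (card_isog isoT1) mul2n card_dihedral.
have pi : ~~ (p %| #|T : T1|%g)%N.
  by apply: PSL2_index_prime_to_p p_pr p_odd pq1 p2q1 isoT sT1T _; rewrite oT1 dvdn_mull.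
have oX : #|X| = #|T : T1|%g.
  by rewrite (card_ind trX) (index_stab sT1T sdprodG defK).
have N_neq0 : #|N|%:R != 0 :> F.
  by rewrite (card_base oL dprodN) natrX expf_neq0.
set w := fun x => rW x ord0 ord0 in rV_ind.
have w_neq0 x : x \in K -> w x != 0.
  by move=> Kx; have := repr_mx_unit rW Kx; rewrite unitmxE det_mx11 unitfE.
have homN f : {in G &, forall x y, f (x * y)%g = f x + f y} ->
    {in N, forall x, f x = 0 :> F}.
  move=> fM x Nx; apply: (additive_on_coprime (n := #|N|) fM _ N_neq0 (expg_cardG Nx)).
  exact: subsetP (normal_sub nNG) x Nx.
have homT1 f : {in T1 &, forall x y, f (x * y)%g = f x + f y} ->
    {in T1, forall x, f x = 0 :> F}.
  by move=> fM; apply: additive_on_dihedral fM (subxx _) p_gt1 isoT1 two_neq0.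
have T1K : T1 \subset K by rewrite defK mulG_subr.
have homK (f : gT -> F) : {in K &, forall x y, f (x * y)%g = f x + f y} ->
    {in K, forall x, f x = 0}.
  move=> fM x; rewrite defK => /mulsgP[n u Nn T1u ->].
  rewrite fM ?(subsetP sNK n Nn) ?(subsetP T1K u T1u) //.
  rewrite (additive_on_coprime (n := #|N|) fM _ N_neq0 (expg_cardG Nn)) ?(subsetP sNK) //.
  by rewrite homT1 ?addr0 // => y z yT1 zT1; rewrite fM ?(subsetP T1K).
(* The witness is the involution z of [L T1] conjugated by the i-th representative. Its a-th
   diagonal entry is [w] at z^(x_i x_a^-1): this is z itself for a = i, giving -1, and lies in
   another line otherwise, giving 1. *)
have refl i : exists2 z, z \in N & rV z = 1%:M - delta_mx i i *+ 2.
  have [z Lz z1] : exists2 z, z \in L T1 & z != 1%g.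
    by apply/trivgPn; rewrite -cardG_gt1 oL ?lcoset_point.
  have Nz := subsetP (line_sub_base dprodN (lcoset_point _ _)) z Lz.
  have rG := rep_in trX.
  have NJ y g : y \in N -> g \in G -> (y ^ g)%g \in N.
    by move=> Ny Gg; rewrite memJ_norm // (subsetP (normal_norm nNG)).
  exists (z ^ enum_val i)%g; first by rewrite NJ ?rG.
  have Gz : (z ^ enum_val i)%g \in G by rewrite (subsetP (normal_sub nNG)) ?NJ ?rG.
  rewrite rV_ind //; apply/matrixP=> a b; rewrite !mxE /=.
  set y := (z ^ (enum_val i * (enum_val a)^-1))%g.
  have Ny : y \in N by rewrite NJ ?groupM ?groupV ?rG.
  have -> : (enum_val a * z ^ enum_val i * (enum_val b)^-1)%g =
            (y * (enum_val a * (enum_val b)^-1))%g.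
    by rewrite /y !conjgE invMg invgK !mulgA mulgKV.
  rewrite groupMl ?(subsetP sNK y Ny) //.
  have [<-{b} | ab] := eqVneq a b; last first.
    case: ifP => [/(rep_inj trX) eab | _]; first by rewrite eab eqxx in ab.
    have -> : (a == i) && (b == i) = false.
      by apply: contraNF ab => /andP[/eqP-> /eqP->].
    by rewrite addr0 subr0.
  rewrite mulgV group1 mulg1 andbb /w /y.
  have [-> | ai] := eqVneq a i.
    rewrite mulgV conjg1 rW_L1 // !mxE eqxx.
    by rewrite opprD addrA subrr add0r.
  have [||C [TC CT1] Cz] := conj_line_neq sT1T oL dprodN sdprodG actL defK Lz
      (g := (enum_val i * (enum_val a)^-1)%g).
  - by rewrite groupM ?groupV ?rG.
  - by apply: contra ai => /(rep_inj trX)->.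
  by rewrite (rW_L C) // !mxE eqxx addr0 subr0.
have nspan : ~ spanned_by_semisimple rV.
  (* The entry that will vanish is at the coset [K] (index [i0]) and the coset of t^-1 (index
     [j]). *)
  have [i0 Ki0] := rep_exists trX (group1 G).
  have Gt : t \in G by rewrite -(sdprodW sdprodG) (subsetP (mulG_subr _ _)).
  rewrite mul1g groupV in Ki0.
  have [j Kj] := rep_exists trX (groupVr Gt).
  apply: (not_spanned_ind rV_ind w_neq0 (i := i0) (j := j)) => g Gg dg.
  have gker : (g ^+ #[g]`_[pchar F]^')%g \in rker rV.
    by apply/rkerP; rewrite groupX // diagonalizable_repr_pchar'.
  (* Otherwise the coset of [t] would contain 1, whose order is prime to [p]. *)
  have sT1 : ~~ (T \subset T1).
    apply/negP=> sTT1; have := tT1 1%g.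
    by rewrite order1 coprime1n mem_lcoset mulg1 groupV (subsetP sTT1) // => /(_ isT).
  have kerK : rker rV \subset K.
    apply/subsetP=> h /rkerP[Gh h1].
    have: moves K i0 h i0.
      by rewrite -(ind_entry_neq0 rV_ind w_neq0) // h1 mxE eqxx oner_neq0.
    by rewrite /moves groupMr ?groupV // groupMl.
  have := core_trivial sT1T sdprodG defK simT sT1 (rker_normal rV) kerK gker.
  rewrite (remgrX_sdprod sdprodG) // => sr; apply/negP=> mij.
  (* If [g] moved [i0] to [j], then with s the [T]-part of [g], s t would lie in [T1], so s^-1 would
     be an element of [t *: T1] of order prime to [p]. *)
  have Kgt : (g * t)%g \in K.
    have := groupM mij (groupVr Kj); rewrite invMg !invgK !mulgA mulgKV.
    by rewrite -mulgA groupMl.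
  move: Kgt; rewrite (mem_stab sT1T sdprodG defK) ?groupM //.
  rewrite (remgr_morph sdprodG) // (remgr_id (base_tiT sdprodG) Tt) => T1gt.
  have /negP[] : ~~ coprime #[(remgr N T g)^-1]%g p.
    by apply: tT1; rewrite mem_lcoset -invMg groupV.
  rewrite orderV; apply: (@coprime_dvdl _ #[g]%g`_[pchar F]^').
    by rewrite order_dvdn sr.
  by rewrite coprime_sym (@pnat_coprime [pchar F]) ?part_pnat // pnatE.
split; last by split=> // -[].
  split=> //; apply: (reflections_abs_irr trX rV_ind w_neq0 two_neq0) => i.
  by have [z Nz zE] := refl i; exists z => //; apply: (subsetP (normal_sub nNG)).
have [i0 _] := rep_exists trX (group1 G).
split; last 1 first.
- apply: (H1_zero_ind_end sKG trX rV_ind w_neq0 i0 nNG N_neq0 _ homK) => A fixA.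
  apply: (reflections_fixed_diag (rV := rV) two_neq0) => i; have [z Nz zE] := refl i.
  by exists z => //; split; [apply: (subsetP (normal_sub nNG)) | apply: fixA].
(* For the trivial action a cocycle is an additive map and coboundaries vanish. The map dies on [N]
   by order, and on [T] by simplicity once it dies on [T1]. *)
- move=> f fM; exists 0; rewrite /triv_act => x Gx; rewrite subrr.
  have sTG : T \subset G by have [] := sdprod_context sdprodG.
  have fT : {in T &, forall x y, f (x * y)%g = f x + f y}.
    by move=> y z Ty Tz; apply: fM; apply: (subsetP sTG).
  move: Gx; rewrite -(sdprodW sdprodG) => /mulsgP[n s Nn Ts ->].
  rewrite fM ?(subsetP sTG s Ts) ?(subsetP (normal_sub nNG) n Nn) // /triv_act homN // add0r.
  apply: (additive_on_simple fT simT sT1T) => //.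
    by rewrite -cardG_gt1 oT1 (leq_trans p_gt1) ?leq_pmull.
  by apply: homT1 => y z Ty Tz; apply: fT; apply: (subsetP sT1T).
by rewrite oX.
Qed.
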